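(* Let $m\geq 1$. The number of descending plane partitions of dimension $m$ is $$\det\left(\binom{i+j-1}{j-1}+\delta_{i,j}-\delta_{i+1,j}\right)_{1\leq i,j\leq m-1}.$$
   Context: A descending plane partition is a (possibly empty) array $\pi=(a_{i,j})$ of positive integers with rows $i=1,\dots,k$, where row $i$ is nonempty and consists of the entries $a_{i,i},a_{i,i+1},\dots,a_{i,\mu_i}$ (so $\mu_i\geq i$ and row $i$ has length $\mu_i-i+1$), such that: (1) rows are weakly decreasing: $a_{i,j}\geq a_{i,j+1}$ for $1\leq i\leq k$ and $i\leq j<\mu_i$; (2) columns are strictly decreasing: $a_{i,j}>a_{i+1,j}$ for $1\leq i\leq k-1$ and $i<j\leq\mu_{i+1}$; (3) $a_{i,i}>\mu_i-i+1$ for $1\leq i\leq k$, i.e. the first part of each row is greater than the length of that row; (4) $a_{i,i}\leq\mu_{i-1}-(i-1)+1$ for $2\leq i\leq k$, i.e. the first part of each row is at most the length of the preceding row. (These conditions imply $\mu_1\geq\mu_2\geq\cdots\geq\mu_k\geq k$.) The empty array is a descending plane partition. The parts of $\pi$ are the numbers, with repetitions, appearing in the array. $\pi$ has dimension $m$ if no part is greater than $m$ (so the count includes the empty array). Here $\delta_{x,y}$ is the Kronecker delta, and the determinant of the empty ($0\times 0$) matrix is $1$. *)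

(* Defs.v *)
From mathcomp Require Import all_boot all_order all_algebra.
From mathcomp Require Import finmap.

Set Implicit Arguments.
Unset Strict Implicit.
Unset Printing Implicit Defensive.

Local Open Scope nat_scope.

(* A shifted array is stored as the list of its rows: row i (1-based) is the  *)
(* list [:: a_{i,i}; a_{i,i+1}; ...; a_{i,mu_i}].                             *)
Definition shifted_array := seq (seq nat).

Definition row_of (pi : shifted_array) (i : nat) : seq nat :=
  nth [::] pi (i - 1).

(* The column index mu_i of the last entry of row i (for 1 <= i <= k, when    *)
(* row i is nonempty), so that row i has mu_i - i + 1 entries.                *)
Definition mu (pi : shifted_array) (i : nat) : nat :=
  i + size (row_of pi i) - 1.

(* a_{i,j}; meaningful for 1 <= i <= k and i <= j <= mu_i.                    *)
Definition entry (pi : shifted_array) (i j : nat) : nat :=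
  nth 0 (row_of pi i) (j - i).

Definition parts (pi : shifted_array) : seq nat := flatten pi.

Record is_dpp (pi : shifted_array) : Prop := IsDPP {
  dpp_rows_nonempty :
    forall i, 1 <= i <= size pi -> row_of pi i <> [::];
  dpp_parts_pos :
    forall x, x \in parts pi -> 0 < x;
  dpp_rows_weakly_decreasing :
    forall i j, 1 <= i <= size pi -> i <= j < mu pi i ->
      entry pi i j >= entry pi i j.+1;
  dpp_columns_strictly_decreasing :
    forall i j, 1 <= i <= size pi - 1 -> i < j <= mu pi i.+1 ->
      entry pi i j > entry pi i.+1 j;
  dpp_first_part_gt_length :
    forall i, 1 <= i <= size pi -> entry pi i i > mu pi i - i + 1;
  dpp_first_part_le_prev_length :
    forall i, 2 <= i <= size pi ->
      entry pi i i <= mu pi (i - 1) - (i - 1) + 1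
}.

Definition has_dimension (m : nat) (pi : shifted_array) : Prop :=
  forall x, x \in parts pi -> x <= m.

Local Open Scope ring_scope.

(* The (i, j) entry with 1-based i and j.                                     *)
Definition dpp_coef (i j : nat) : int :=
  'C(i + j - 1, j - 1)%N%:Z + (i == j)%:Z - (i.+1 == j)%:Z.

(* Ordinals are 0-based, hence the shift of both indices.                     *)
Definition dpp_mx (n : nat) : 'M[int]_n :=
  \matrix_(i < n, j < n) dpp_coef i.+1 j.+1.

(* Main.v *)
Require Import Defs.
From mathcomp Require Import all_boot all_order all_algebra.
From mathcomp Require Import finmap.
From mathcomp Require Import all_fingroup zify.

Import GRing.Theory.

(* Let a_1 > ... > a_k be the first parts of the rows and l_1 > ... > l_k the   *)
(* row lengths, so that a_(i+1) <= l_i < a_i.  For fixed a and l, consecutive   *)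
(* columns interlace: a_i >= b_i > a_(i+1).  Subtracting consecutive rows and   *)
(* expanding by multilinearity shows that det (h (a_i, l_j)), where h (a, l) is *)
(* the number of possible rows with first part a and length l, satisfies the    *)
(* recursion obtained by deleting the first column; hence it counts the         *)
(* fillings.  In the same way, subtracting consecutive columns in               *)
(* det (B (a_i, a_j)), with B (a, b) the sum of h (a, l) over 1 <= l < b, sums  *)
(* over all admissible l.  Summing these principal minors over all subsets a of *)
(* {2, ..., m} gives det (1 + B), and differences of consecutive columns turn   *)
(* 1 + B into the matrix of the theorem.                                        *)

Local Open Scope ring_scope.

(** * Determinants of matrices indexed by natural numbers *)

(** In terms of first parts [a] and row lengths [l], the conditions on a descending plane partition
    are 1 <= l_i, a_(i+1) <= l_i < a_i and a filling condition ([mem_dpps]), so the count is a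
    threefold sum, and each sum is absorbed into one determinant: the fillings by [size_fillings],
    the lengths by [sum_row_lengths], the first parts by [ndet_add1_principal_minors]. The first two
    use the same mechanism: [ndet_rowB] creates differences of consecutive rows, these are sums over
    intervals, and [ndet_row_sum] pulls the sums out. [size_dpps] identifies the final matrix;
    [mem_dpps] and [uniq_dpps] turn the length of the list [dpps m] into the cardinality. *)

Definition ndet {R : comNzRingType} (n : nat) (f : nat -> nat -> R) : R :=
  \det (\matrix_(i < n, j < n) f i j).

Section Ndet.
Variable R : comNzRingType.
Implicit Types f g h : nat -> nat -> R.

Lemma eq_ndet n f g :
  (forall i j, (i < n)%N -> (j < n)%N -> f i j = g i j) ->
  ndet n f = ndet n g.
Proof. by move=> fg; congr (\det _); apply/matrixP=> i j; rewrite !mxE fg. Qed.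

Lemma ndet_tr n f : ndet n f = ndet n (fun i j => f j i).
Proof. by rewrite /ndet -det_tr; congr (\det _); apply/matrixP=> i j; rewrite !mxE. Qed.

(** The same permutation acts on rows and columns, so its sign occurs twice and cancels. Needed
    because first parts are listed in decreasing order. *)
Lemma ndet_rev n f :
  ndet n f = ndet n (fun i j => f (n - i.+1)%N (n - j.+1)%N).
Proof.
pose s : 'S_n := perm (inv_inj (@rev_ordK n)).
rewrite /ndet; set A := (X in \det X = _).
have -> : \matrix_(i < n, j < n) f (n - i.+1)%N (n - j.+1)%N
          = row_perm s (col_perm s A).
  by apply/matrixP=> i j; rewrite !mxE !permE.
by rewrite row_permE col_permE !det_mulmx !det_perm odd_permV mulrCA -signr_addb
           addbb mulr1.
Qed.

(** Left multiplication by a unitriangular matrix. The hypothesis supplies a zero row past the end,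
    so that the last row follows the same formula as the others. *)
Lemma ndet_rowB n f :
  (forall j, (j < n)%N -> f n j = 0) ->
  ndet n f = ndet n (fun i j => f i j - f i.+1 j).
Proof.
move=> fn0.
pose U : 'M[R]_n := \matrix_(i, j) ((i == j)%:R - (i.+1 == j)%:R).
have detU : \det U = 1.
  rewrite -det_tr det_trig; last first.
    apply/is_trig_mxP=> i j ltij; rewrite !mxE.
    have -> : (j == i) = false by apply/eqP=> ji; move: ltij; rewrite ji ltnn.
    by have -> : (j.+1 == i)%N = false ; [lia | rewrite subr0].
  rewrite big1 // => i _; rewrite !mxE eqxx.
  by have -> : (i.+1 == i)%N = false ; [lia | rewrite subr0].
rewrite /ndet -[LHS]mul1r -detU -det_mulmx; congr (\det _).
apply/matrixP=> i j; rewrite !mxE.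
under eq_bigr => k _ do rewrite !mxE mulrBl.
rewrite sumrB; congr (_ - _).
  rewrite (bigD1 i) //= eqxx mul1r big1 ?addr0 // => k ki.
  by rewrite eq_sym (negPf ki) mul0r.
have [lt_in|ge_in] := ltnP i.+1 n.
  rewrite (bigD1 (Ordinal lt_in)) //= eqxx mul1r big1 ?addr0 // => k ki.
  have -> : (i.+1 == k)%N = false; last by rewrite mul0r.
  by apply: contraNF ki => /eqP ik; apply/eqP/val_inj.
have -> : i.+1 = n by have := ltn_ord i; lia.
rewrite fn0 // big1 // => k _.
by have -> : (n == k)%N = false; [have := ltn_ord k; lia | rewrite mul0r].
Qed.

Lemma ndet_unit_row n i f :
  (i <= n)%N -> (forall j, (j <= n)%N -> f i j = (i == j)%:R) ->
  ndet n.+1 f = ndet n (fun p q => f (bump i p) (bump i q)).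
Proof.
rewrite -ltnS => lt_in fi; pose o := Ordinal lt_in.
rewrite /ndet (expand_det_row _ o) (bigD1 o) //= !mxE fi // eqxx mul1r.
rewrite big1 ?addr0 => [|j jo]; last first.
  rewrite !mxE fi /=; last by rewrite -ltnS.
  have -> : (i == j)%N = false; last by rewrite mul0r.
  by apply: contraNF jo => /eqP ij; apply/eqP/val_inj.
rewrite /cofactor addnn -signr_odd odd_double mul1r.
by congr (\det _); apply/matrixP=> p q; rewrite !mxE.
Qed.

Lemma ndet_row_add n i f g h :
  (i < n)%N -> (forall j, (j < n)%N -> f i j = g i j + h i j) ->
  (forall p j, p != i -> g p j = f p j /\ h p j = f p j) ->
  ndet n f = ndet n g + ndet n h.
Proof.
move=> lt_in fi fgh; pose o := Ordinal lt_in.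
rewrite /ndet -[\det (\matrix_(_, _) g _ _)]mul1r -[\det (\matrix_(_, _) h _ _)]mul1r.
apply: (@determinant_multilinear _ _ _ _ _ o).
- by apply/rowP=> j; rewrite !mxE !mul1r /= fi.
- apply/matrixP=> p q; rewrite !mxE.
  by have [|-> //] := fgh (lift o p) q; rewrite eq_sym neq_bump.
- apply/matrixP=> p q; rewrite !mxE.
  by have [|_ -> //] := fgh (lift o p) q; rewrite eq_sym neq_bump.
Qed.

End Ndet.

(** * Cartesian products and multilinear expansion in all rows *)

Fixpoint seqprod {T : Type} (ss : seq (seq T)) : seq (seq T) :=
  if ss is s :: ss' then [seq x :: b | x <- s, b <- seqprod ss'] else [:: [::]].

Lemma mem_seqprod {T : eqType} (x0 : T) (ss : seq (seq T)) (b : seq T) :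
  b \in seqprod ss <->
  size b = size ss /\
  (forall i, (i < size ss)%N -> nth x0 b i \in nth [::] ss i).
Proof.
elim: ss b => [|s ss IH] b /=.
  by rewrite inE; split=> [/eqP->|[/size0nil->]].
split=> [/allpairsP[[x c] /= [xs /IH[sc Hc] ->]]|].
  by split=> [|[|i] //]; [rewrite /= sc | exact: Hc].
case: b => [[]//|x c] [[sc] Hc]; apply: allpairs_f; first exact: (Hc 0).
by apply/IH; split=> // i; apply: (Hc i.+1).
Qed.

Lemma uniq_seqprod {T : eqType} (ss : seq (seq T)) :
  all uniq ss -> uniq (seqprod ss).
Proof.
elim: ss => //= s ss IH /andP[us /IH uss].
by apply: allpairs_uniq => // -[x b] [y c] _ _ [-> ->].
Qed.

Lemma prod_sum_seqprod {R : comNzRingType} {T : Type} (x0 : T)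
    (ss : seq (seq T)) (F : 'I_(size ss) -> T -> R) :
  \prod_(i < size ss) \sum_(x <- nth [::] ss i) F i x
  = \sum_(b <- seqprod ss) \prod_(i < size ss) F i (nth x0 b i).
Proof.
elim: ss F => [|s ss IH] F /=; first by rewrite big_ord0 big_seq1 big_ord0.
rewrite big_ord_recl /= (IH (fun i => F (lift ord0 i))) big_distrlr /=.
rewrite big_allpairs_dep; apply: eq_bigr => x _; apply: eq_bigr => b _.
by rewrite big_ord_recl.
Qed.

(** Distributivity is applied to each term of the Leibniz formula: every term takes exactly one
    factor from each row. *)
Lemma ndet_row_sum {R : comNzRingType} {T : Type} (x0 : T)
    (ss : seq (seq T)) (g : T -> nat -> R) :
  ndet (size ss) (fun i j => \sum_(x <- nth [::] ss i) g x j)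
  = \sum_(b <- seqprod ss) ndet (size ss) (fun i j => g (nth x0 b i) j).
Proof.
rewrite /ndet /determinant exchange_big /=; apply: eq_bigr => s _.
rewrite -big_distrr /=; congr (_ * _).
under eq_bigr => i _ do rewrite mxE.
rewrite (prod_sum_seqprod x0 ss (fun i x => g x (s i))).
by apply: eq_bigr => b _; apply: eq_bigr => i _; rewrite mxE.
Qed.

(** * Expansion into principal minors *)

Fixpoint subseqs {T : Type} (s : seq T) : seq (seq T) :=
  if s is x :: s' then [seq x :: t | t <- subseqs s'] ++ subseqs s'
  else [:: [::]].

Lemma mem_subseqs {T : eqType} (s t : seq T) : (t \in subseqs s) = subseq t s.
Proof.
elim: s t => [|x s IH] t /=; first by rewrite inE; case: t.
rewrite mem_cat; case: t => [|y t] /=; first by rewrite IH sub0seq orbT.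
rewrite IH; have [->|neq_yx] := eqVneq y x.
  rewrite mem_map; last by move=> ? ? [].
  rewrite IH; apply/idP/idP=> [/orP[//|]|->//].
  by apply: subseq_trans; apply: subseq_cons.
rewrite orb_idl // => /mapP[u _ [yx _]].
by rewrite yx eqxx in neq_yx.
Qed.

Lemma uniq_subseqs {T : eqType} (s : seq T) : uniq s -> uniq (subseqs s).
Proof.
elim: s => //= x s IH /andP[xs us]; rewrite cat_uniq IH // andbT.
rewrite map_inj_uniq ?IH //=; last by move=> ? ? [].
apply/hasPn=> t; rewrite mem_subseqs => ts.
apply: contra xs => /mapP[u _ tE].
by apply: (mem_subseq ts); rewrite tE mem_head.
Qed.

Section PrincipalMinors.
Variables (R : comNzRingType) (T : Type) (x0 : T) (B : T -> T -> R).

(* The identity is added only on the indices coming from [u]; moving them one *)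
(* by one to [t] interpolates between [det (1 + B)] and the minors of [B].    *)
Let pdet (t u : seq T) : R :=
  ndet (size (t ++ u)) (fun i j =>
    B (nth x0 (t ++ u) i) (nth x0 (t ++ u) j)
    + ((i == j) && (size t <= i)%N)%:R).

(** Additivity in the row of [x]: its [B] part moves [x] into [t], and its unit vector deletes the
    row and column of [x]. *)
Let pdet_cons t x u : pdet t (x :: u) = pdet (rcons t x) u + pdet t u.
Proof.
rewrite /pdet cat_rcons size_rcons; set s := t ++ x :: u.
have lts : (size t < size s)%N by rewrite size_cat /=; lia.
pose f i j := B (nth x0 s i) (nth x0 s j) + ((i == j) && (size t <= i)%N)%:R.
rewrite (@ndet_row_add _ _ (size t) _
  (fun i j => B (nth x0 s i) (nth x0 s j) + ((i == j) && (size t < i)%N)%:R)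
  (fun i j => if i == size t then (i == j)%:R else f i j)) //; last 2 first.
- by move=> j _; rewrite eqxx ltnn andbF addr0 leqnn andbT.
- move=> p j pt; rewrite (negPf pt); split=> //.
  by rewrite ltn_neqAle (eq_sym (size t)) pt.
congr (_ + _).
have -> : size s = (size (t ++ u)).+1 by rewrite /s !size_cat addnS.
rewrite (@ndet_unit_row _ _ (size t)); first last.
- by move=> j _; rewrite eqxx.
- by rewrite size_cat leq_addr.
have nthE p : nth x0 s (bump (size t) p) = nth x0 (t ++ u) p.
  rewrite /s /bump !nth_cat; case: (leqP (size t) p) => le_tp; last first.
    by rewrite add0n le_tp.
  by rewrite add1n ltnNge ltnW //= ?ltnS // subSn.
apply: eq_ndet => i j _ _; rewrite eq_sym (negPf (neq_bump _ _)) /f !nthE.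
rewrite (inj_eq (can_inj (bumpK _))); congr (_ + (_ && _)%:R).
by rewrite /bump; lia.
Qed.

Lemma ndet_add1_principal_minors (s : seq T) :
  ndet (size s) (fun i j => B (nth x0 s i) (nth x0 s j) + (i == j)%:R)
  = \sum_(t <- subseqs s) ndet (size t) (fun i j => B (nth x0 t i) (nth x0 t j)).
Proof.
suff H t : pdet t s = \sum_(u <- subseqs s) pdet (t ++ u) [::].
  transitivity (pdet [::] s).
    by apply: eq_ndet => i j _ _; rewrite andbT.
  rewrite H; apply: eq_bigr => u _; rewrite /pdet /= cats0.
  by apply: eq_ndet => i j lti _; rewrite leqNgt lti andbF addr0.
elim: s t => [|x s IH] t /=; first by rewrite big_seq1 cats0.
rewrite pdet_cons !IH big_cat big_map /=; congr (_ + _).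
by apply: eq_bigr => u _; rewrite cat_rcons.
Qed.

End PrincipalMinors.

(** * Fillings with prescribed first column and row lengths *)

(* The number of weakly decreasing sequences of [l] positive integers that    *)
(* start with [a], for [0 < l]; the value [0] at [a = 0] makes differences of *)
(* consecutive rows uniform, as [nth 0 a i = 0] past the end of [a].          *)
Definition row_count (a l : nat) : nat :=
  if a is a'.+1 then 'C(a' + l.-1, l.-1) else 0.

(** Pascal's rule; in terms of rows, the second entry either equals the first or is smaller. *)
Lemma row_countS a l :
  (0 < l)%N -> row_count a.+1 l.+1 = (row_count a l.+1 + row_count a.+1 l)%N.
Proof.
case: l => // l _; case: a => [|a] /=; first by rewrite !add0n !binn.
by rewrite addSn binS -addSnnS.
Qed.

Lemma sum_row_count lo hi l : (lo <= hi)%N -> (0 < l)%N ->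
  \sum_(b <- iota lo.+1 (hi - lo)) (row_count b l)%:Z
  = (row_count hi l.+1)%:Z - (row_count lo l.+1)%:Z.
Proof.
move=> le_lohi l_gt0; rewrite -{2}(subnKC le_lohi).
elim: (hi - lo)%N => [|d IH]; first by rewrite big_nil addn0 subrr.
rewrite addnS -[d.+1]addn1 iotaD big_cat big_seq1 IH addSn row_countS //.
by rewrite PoszD addrAC.
Qed.

(* With the default value [0], this also says that all entries are positive.  *)
Definition strict_desc (s : seq nat) : Prop :=
  forall i, (i < size s)%N -> (nth 0%N s i.+1 < nth 0%N s i)%N.

(** Rows and offsets within a row count from 0. Because rows are shifted, offset [p.+1] of row [i]
    lies above offset [p] of row [i.+1]. *)
Definition entry0 (pi : shifted_array) (i p : nat) : nat :=
  nth 0%N (nth [::] pi i) p.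

Record is_filling (l a : seq nat) (pi : shifted_array) : Prop := IsFilling {
  filling_sizes : map size pi = l;
  filling_heads : map (head 0%N) pi = a;
  filling_rows : forall i p, (p.+1 < size (nth [::] pi i))%N ->
    (entry0 pi i p.+1 <= entry0 pi i p)%N;
  filling_cols : forall i p, (p < size (nth [::] pi i.+1))%N ->
    (entry0 pi i.+1 p < entry0 pi i p.+1)%N;
  filling_pos : forall i p, (p < size (nth [::] pi i))%N ->
    (0 < entry0 pi i p)%N
}.

(** The possible lists of second entries of the first [k] rows: each is at most the first part of
    its own row and exceeds that of the row below, or the default 0 if there is none. *)
Definition next_columns (k : nat) (a : seq nat) : seq (seq nat) :=
  seqprod (mkseq (fun i => iota (nth 0%N a i.+1).+1
                                (nth 0%N a i - nth 0%N a i.+1)) k).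

Lemma mem_next_columns k a b :
  b \in next_columns k a <->
  size b = k /\
  (forall i, (i < k)%N -> (nth 0%N a i.+1 < nth 0%N b i <= nth 0%N a i)%N).
Proof.
rewrite (mem_seqprod 0%N) size_mkseq; split=> -[sb Hb]; split=> // i ltik;
  move: (Hb i ltik); rewrite nth_mkseq // mem_iota /=; lia.
Qed.

Lemma uniq_next_columns k a : uniq (next_columns k a).
Proof.
by apply/uniq_seqprod/allP=> s /mapP[i _ ->]; apply: iota_uniq.
Qed.

Definition zip_cons (a : seq nat) (pi : shifted_array) : shifted_array :=
  mkseq (fun i => nth 0%N a i :: nth [::] pi i) (size a).

(* When the lengths [l] are strictly decreasing, at most the last row has     *)
(* length [1], so at most one row disappears with the first column.           *)
Definition tail_height (l : seq nat) : nat := size l - (last 0%N l == 1%N).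

Definition tail_lengths (l : seq nat) : seq nat :=
  mkseq (fun i => (nth 0%N l i).-1) (tail_height l).

Lemma tail_heightP l i : strict_desc l ->
  (i < tail_height l)%N = (1 < nth 0%N l i)%N.
Proof.
move=> dl; rewrite /tail_height.
have [lt_il|ge_il] := ltnP i (size l); last by rewrite nth_default //; lia.
have := dl i lt_il; have [lt_iSl|ge_iSl] := ltnP i.+1 (size l).
  by have := dl i.+1 lt_iSl; case: (last _ _ == _) => /=; lia.
have iE : i = (size l).-1 by lia.
by rewrite -nth_last -iE; case: eqP => /=; lia.
Qed.

Lemma strict_desc_tail_lengths l : strict_desc l -> strict_desc (tail_lengths l).
Proof.
move=> dl i; rewrite size_mkseq => lt_i; rewrite [nth _ _ i]nth_mkseq //.
move: (lt_i); rewrite tail_heightP // => li.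
have [lt_iS|ge_iS] := ltnP i.+1 (tail_height l).
  rewrite nth_mkseq //; have := dl i.
  by move: lt_iS; rewrite /tail_height; lia.
by rewrite [nth _ _ i.+1]nth_default ?size_mkseq //; lia.
Qed.

Lemma strict_desc_next_columns k a b :
  b \in next_columns k a -> strict_desc b.
Proof.
move=> /mem_next_columns[sb Hb] i; rewrite sb => ltik.
have [lt_iS|ge_iS] := ltnP i.+1 k; last first.
  by rewrite [nth _ _ i.+1]nth_default ?sb //; have := Hb i ltik; lia.
by have := Hb i ltik; have := Hb _ lt_iS; lia.
Qed.

Lemma nth_map_size (pi : shifted_array) i :
  nth 0%N (map size pi) i = size (nth [::] pi i).
Proof.
have [lti|gei] := ltnP i (size pi); first by rewrite (nth_map [::]).
by rewrite !nth_default ?size_map.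
Qed.

Lemma nth_map_head (pi : shifted_array) i :
  nth 0%N (map (head 0%N) pi) i = entry0 pi i 0.
Proof.
rewrite /entry0 nth0.
have [lti|gei] := ltnP i (size pi); first by rewrite (nth_map [::]).
by rewrite [RHS]/= !nth_default ?size_map.
Qed.

(* The first argument is the recursion depth and must be at least the length  *)
(* of the first row.                                                          *)
Fixpoint fillings (n : nat) (l a : seq nat) : seq shifted_array :=
  if n is n'.+1 then
    flatten [seq [seq zip_cons a pi | pi <- fillings n' (tail_lengths l) b]
            | b <- next_columns (tail_height l) a]
  else [:: [::]].

Lemma nth_zip_cons a pi i :
  nth [::] (zip_cons a pi) i =
  if (i < size a)%N then nth 0%N a i :: nth [::] pi i else [::].
Proof.
by case: ltnP => lti; [rewrite nth_mkseq | rewrite nth_default ?size_mkseq].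
Qed.

(** With [filling_zip_cons], this shows that a filling amounts to its second column [b] and a
    filling with first column [b]. The interlacing of [a] and [b] is all that links the two. *)
Lemma zip_cons_filling l a b pi :
  size a = size l -> strict_desc l -> strict_desc a ->
  b \in next_columns (tail_height l) a ->
  is_filling (tail_lengths l) b pi -> is_filling l a (zip_cons a pi).
Proof.
move=> sal dl da /mem_next_columns[sb Hb] [sz hd W C P].
have szi i : size (nth [::] pi i) = (nth 0%N l i).-1.
  rewrite -nth_map_size sz; have [lti|gei] := ltnP i (tail_height l).
    by rewrite nth_mkseq.
  rewrite nth_default ?size_mkseq //.
  by move: gei; rewrite leqNgt tail_heightP //; lia.
have hdi i : entry0 pi i 0 = nth 0%N b i by rewrite -nth_map_head hd.
have rowE i := nth_zip_cons a pi i.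
split.
- apply: (@eq_from_nth _ 0%N); first by rewrite size_map size_mkseq.
  move=> i; rewrite size_map size_mkseq => lti.
  rewrite nth_map_size rowE lti /= szi.
  by have := dl i; rewrite -sal => /(_ lti); lia.
- apply: (@eq_from_nth _ 0%N); first by rewrite size_map size_mkseq.
  move=> i; rewrite size_map size_mkseq => lti.
  by rewrite nth_map_head /entry0 rowE lti.
- move=> i p; rewrite /entry0 rowE; case: ifP => // lti /=; rewrite ltnS => ltp.
  case: p ltp => [|p] ltp /=; last exact: W.
  rewrite -/(entry0 pi i 0) hdi; have /Hb : (i < tail_height l)%N.
    by rewrite tail_heightP //; move: ltp; rewrite szi; lia.
  by case/andP.
- move=> i p; rewrite /entry0 !rowE; case: ifP => // lti /= ltp.
  rewrite (ltnW lti); case: p ltp => [|p] ltp /=; last exact: C.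
  rewrite -/(entry0 pi i 0) hdi; have /Hb : (i < tail_height l)%N.
    (* Row [i.+1] exists and is nonempty, and row [i] is longer, so row [i] has a second entry. *)
    rewrite tail_heightP //; have := dl i; have := dl i.+1.
    by rewrite -sal; lia.
  by case/andP.
- move=> i p; rewrite /entry0 rowE; case: ifP => // lti /= ltp.
  case: p ltp => [|p] ltp /=; last exact: P.
  by have := da i lti; lia.
Qed.

Lemma filling_zip_cons l a pi :
  strict_desc l -> is_filling l a pi ->
  exists b pi', [/\ b \in next_columns (tail_height l) a,
    is_filling (tail_lengths l) b pi' & pi = zip_cons a pi'].
Proof.
move=> dl [sz hd W C P].
have spl : size pi = size l by rewrite -sz size_map.
have spa : size pi = size a by rewrite -hd size_map.
have szi i : size (nth [::] pi i) = nth 0%N l i by rewrite -nth_map_size sz.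
have hdi i : entry0 pi i 0 = nth 0%N a i by rewrite -nth_map_head hd.
pose pi' := mkseq (fun i => behead (nth [::] pi i)) (tail_height l).
have rowE i : nth [::] pi' i = behead (nth [::] pi i).
  have [lti|gei] := ltnP i (tail_height l); first by rewrite nth_mkseq.
  rewrite nth_default ?size_mkseq //; apply/esym/size0nil; rewrite size_behead szi.
  by move: gei; rewrite leqNgt tail_heightP //; lia.
have entE i p : entry0 pi' i p = entry0 pi i p.+1.
  by rewrite /entry0 rowE nth_behead.
have szi' i : size (nth [::] pi' i) = (nth 0%N l i).-1.
  by rewrite rowE size_behead szi.
exists (map (head 0%N) pi'), pi'; split.
- apply/mem_next_columns; rewrite size_map size_mkseq; split=> // i.
  rewrite tail_heightP // nth_map_head entE -!hdi => gt1.
  rewrite W ?szi // andbT.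
  have [lti|gei] := ltnP i.+1 (size l); last first.
    by rewrite [entry0 _ i.+1 0]hdi nth_default -?spa ?spl // P // szi.
  by rewrite C // szi; have := dl _ lti; lia.
- split=> //.
  + apply: (@eq_from_nth _ 0%N); first by rewrite size_map !size_mkseq.
    move=> i; rewrite size_map size_mkseq => lti.
    by rewrite nth_map_size szi' nth_mkseq.
  + by move=> i p; rewrite szi' !entE => ltp; apply: W; rewrite szi; lia.
  + by move=> i p; rewrite szi' !entE => ltp; apply: C; rewrite szi; lia.
  + by move=> i p; rewrite szi' !entE => ltp; apply: P; rewrite szi; lia.
- apply: (@eq_from_nth _ [::]); first by rewrite size_mkseq.
  move=> i lti; rewrite nth_mkseq -?spa // rowE -hdi /entry0.
  have := szi i; have := dl i; rewrite -spl => /(_ lti).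
  by case: (nth [::] pi i) => //=; lia.
Qed.

Lemma strict_desc_nil s : strict_desc s -> (head 0%N s <= 0)%N -> s = [::].
Proof. by case: s => // x s /(_ 0%N isT) /=; lia. Qed.

Lemma tail_lengths_head l n :
  (head 0%N l <= n.+1)%N -> (head 0%N (tail_lengths l) <= n)%N.
Proof.
rewrite -!nth0 => le_ln; have [lt0|ge0] := ltnP 0 (tail_height l).
  by rewrite nth_mkseq //; lia.
by rewrite nth_default ?size_mkseq.
Qed.

Lemma mem_fillings n l a pi :
  size a = size l -> strict_desc l -> strict_desc a -> (head 0%N l <= n)%N ->
  pi \in fillings n l a <-> is_filling l a pi.
Proof.
elim: n l a pi => [|n IH] l a pi sal dl da le_ln.
  move: sal; rewrite (strict_desc_nil _ dl le_ln) => /size0nil -> /=; rewrite inE.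
  split=> [/eqP->|[sz _ _ _ _]]; first by split=> // i p; rewrite nth_nil.
  by case: pi sz.
have IH' b pi' : b \in next_columns (tail_height l) a ->
    pi' \in fillings n (tail_lengths l) b <-> is_filling (tail_lengths l) b pi'.
  move=> Hb; apply: IH (tail_lengths_head _ _ le_ln).
  - by rewrite size_mkseq; have /mem_next_columns[] := Hb.
  - exact: strict_desc_tail_lengths.
  - exact: strict_desc_next_columns Hb.
split=> [/flatten_mapP[b Hb /mapP[pi' /(IH' _ _ Hb) fpi' ->]]|].
  exact: zip_cons_filling Hb fpi'.
case/(filling_zip_cons _ _ _ dl) => b [pi' [Hb fpi' ->]].
by apply/flatten_mapP; exists b => //; apply/map_f/IH'.
Qed.

(** The key recovers the block from which an element comes, so distinct blocks are disjoint. *)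
Lemma uniq_flatten_key {S T : eqType} (F : S -> seq T) (key : T -> S) (s : seq S) :
  uniq s -> (forall x, x \in s -> uniq (F x)) ->
  (forall x y, x \in s -> y \in F x -> key y = x) ->
  uniq (flatten [seq F x | x <- s]).
Proof.
elim: s => //= x s IH /andP[xs us] uF kF; rewrite cat_uniq uF ?mem_head //=.
rewrite IH => [|//|y ys|y z ys]; last 2 first.
- by apply: uF; rewrite inE ys orbT.
- by apply: kF; rewrite inE ys orbT.
rewrite andbT; apply/hasPn=> z /flatten_mapP[y ys zy]; apply/negP=> zx.
have yx : y = x by rewrite -(kF y z) ?(kF x z) ?inE ?ys ?eqxx ?orbT.
by rewrite -yx ys in xs.
Qed.

Lemma size_flatten_map {S T : Type} (F : S -> seq T) (s : seq S) :
  (size (flatten [seq F x | x <- s]))%:Z = \sum_(x <- s) (size (F x))%:Z.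
Proof.
elim: s => [|x s IH] /=; first by rewrite big_nil.
by rewrite size_cat PoszD IH big_cons.
Qed.

Lemma uniq_fillings n l a :
  size a = size l -> strict_desc l -> strict_desc a -> (head 0%N l <= n)%N ->
  uniq (fillings n l a).
Proof.
elim: n l a => [//|n IH] l a sal dl da le_ln /=.
have sb b : b \in next_columns (tail_height l) a -> size b = size (tail_lengths l).
  by rewrite size_mkseq => /mem_next_columns[].
have dtl := strict_desc_tail_lengths _ dl.
have hn := tail_lengths_head _ _ le_ln.
(* Deleting the first column undoes [zip_cons]; [take] discards the row of length 1, if any, which
   has become empty. *)
have behK b pi : b \in next_columns (tail_height l) a ->
    pi \in fillings n (tail_lengths l) b ->
    take (tail_height l) (map behead (zip_cons a pi)) = pi.
  move=> Hb /mem_fillings[//||||sz _ _ _ _]; rewrite ?sb //.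
    exact: strict_desc_next_columns Hb.
  have spi : size pi = tail_height l by rewrite -(size_map size) sz size_mkseq.
  have leh : (tail_height l <= size a)%N by rewrite /tail_height sal; lia.
  apply: (@eq_from_nth _ [::]); rewrite size_take size_map size_mkseq.
    by rewrite spi; case: ltngtP leh.
  move=> i lti; have lti' : (i < tail_height l)%N by move: lti leh; case: ifP; lia.
  rewrite nth_take // (nth_map [::]) ?size_mkseq ?(leq_trans lti') //.
  by rewrite nth_mkseq // (leq_trans lti').
apply: (uniq_flatten_key _
  (fun pi => map (head 0%N) (take (tail_height l) (map behead pi)))).
- exact: uniq_next_columns.
- move=> b Hb; rewrite map_inj_in_uniq.
    by apply: IH => //; [exact: sb | exact: strict_desc_next_columns Hb].
  by move=> pi pi' Hpi Hpi' E; rewrite -(behK b pi) // E (behK b).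
- move=> b y Hb /mapP[pi Hpi ->]; rewrite (behK b) //.
  move: Hpi => /mem_fillings[//||||//]; rewrite ?sb //.
  exact: strict_desc_next_columns Hb.
Qed.

(** A determinant of Gessel-Viennot type, proved by induction on the columns. By [sum_row_count],
    differences of consecutive rows are sums over the possible second entries, with all lengths
    reduced by 1; multilinearity then gives the recursion that defines [fillings]. *)
Lemma size_fillings n l a :
  size a = size l -> strict_desc l -> strict_desc a -> (head 0%N l <= n)%N ->
  (size (fillings n l a))%:Z
  = ndet (size l) (fun i j => (row_count (nth 0%N a i) (nth 0%N l j))%:Z).
Proof.
elim: n l a => [|n IH] l a sal dl da le_ln.
  by rewrite (strict_desc_nil _ dl le_ln) /ndet det_mx00.
rewrite /= size_flatten_map.
rewrite ndet_rowB; last by move=> j _; rewrite nth_default ?sal.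
set f := (X in _ = ndet _ X).
(* If the last length is 1, the last column of [f] is the last unit vector, because [row_count x 1]
   is 1 for positive [x] and 0 for the default entry past the end of [a]. Expanding along it drops
   the row that has no second entry. *)
have -> : ndet (size l) f = ndet (tail_height l) f.
  have [lasteq|lastne] := eqVneq (last 0%N l) 1%N; last first.
    by rewrite /tail_height (negPf lastne) subn0.
  rewrite /tail_height lasteq eqxx subn1.
  case sl : (size l) => [//|k] /=.
  have lk : nth 0%N l k = 1%N by rewrite -lasteq -nth_last sl.
  rewrite ndet_tr (@ndet_unit_row _ _ k) // => [|j lejk]; last first.
    rewrite /f lk; have := da j; rewrite sal sl ltnS => /(_ lejk).
    case: (ltngtP j k) lejk => // [ltjk|->] _.
      have := da j.+1; rewrite sal sl ltnS => /(_ ltjk).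
      by case: (nth 0%N a j) (nth 0%N a j.+1) => [|x] [|y] //=; rewrite !bin0 subrr.
    rewrite [nth _ _ k.+1]nth_default ?sal ?sl //.
    by case: (nth 0%N a k) => //= x _; rewrite bin0 subr0.
  rewrite ndet_tr; apply: eq_ndet => i j lti ltj.
  by rewrite /bump leqNgt lti leqNgt ltj.
have hs := size_mkseq (fun i => iota (nth 0%N a i.+1).+1
                            (nth 0%N a i - nth 0%N a i.+1)) (tail_height l).
pose g b j := (row_count b (nth 0%N (tail_lengths l) j))%:Z : int.
transitivity (\sum_(b <- next_columns (tail_height l) a)
    ndet (tail_height l) (fun i j => g (nth 0%N b i) j)).
  apply: eq_big_seq => b Hb; have /mem_next_columns[sb _] := Hb.
  rewrite size_map IH ?size_mkseq //.
  - exact: strict_desc_tail_lengths.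
  - exact: strict_desc_next_columns Hb.
  - exact: tail_lengths_head.
rewrite -{2}hs -ndet_row_sum hs; apply: eq_ndet => i j lti ltj.
have lta : (i < size a)%N by rewrite sal; move: lti; rewrite /tail_height; lia.
have gt1 : (1 < nth 0%N l j)%N by rewrite -tail_heightP.
rewrite nth_mkseq // /g nth_mkseq // sum_row_count; [|exact/ltnW/da|lia].
by rewrite /f prednK // ltnW.
Qed.

(** * Enumeration of the descending plane partitions *)

Definition row_lengths (a : seq nat) : seq (seq nat) :=
  seqprod (mkseq (fun i => index_iota (maxn 1 (nth 0%N a i.+1)) (nth 0%N a i))
                 (size a)).

Lemma mem_row_lengths a l :
  l \in row_lengths a <->
  size l = size a /\
  (forall i, (i < size a)%N ->
     (maxn 1 (nth 0%N a i.+1) <= nth 0%N l i < nth 0%N a i)%N).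
Proof.
rewrite (mem_seqprod 0%N) size_mkseq; split=> -[sl Hl]; split=> // i ltia;
  by move: (Hl i ltia); rewrite nth_mkseq // mem_index_iota.
Qed.

Lemma uniq_row_lengths a : uniq (row_lengths a).
Proof.
by apply/uniq_seqprod/allP=> s /mapP[i _ ->]; apply: iota_uniq.
Qed.

Lemma strict_desc_row_lengths a l : l \in row_lengths a -> strict_desc l.
Proof.
move=> /mem_row_lengths[sl Hl] i; rewrite sl => ltia.
have [lt_iS|ge_iS] := ltnP i.+1 (size a); last first.
  by rewrite [nth _ _ i.+1]nth_default ?sl //; have := Hl i ltia; lia.
by have := Hl i ltia; have := Hl _ lt_iS; lia.
Qed.

Definition row_count_below (a b : nat) : int :=
  \sum_(1 <= l < b) (row_count a l)%:Z.

Lemma row_count_below0 a : row_count_below a 0 = 0.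
Proof. by rewrite /row_count_below big_geq. Qed.

Lemma row_count_belowB a b c : (c < b)%N ->
  row_count_below a b - row_count_below a c
  = \sum_(maxn 1 c <= l < b) (row_count a l)%:Z.
Proof.
case: c => [|c] ltcb; first by rewrite row_count_below0 subr0.
have -> : maxn 1 c.+1 = c.+1 by lia.
rewrite /row_count_below (@big_cat_nat _ _ _ c.+1 1 b) //=; last exact: ltnW.
by rewrite addrAC subrr add0r.
Qed.

(** The admissible values of l_j form an interval ending below a_j and starting at a_(j+1), or at 1
    if that is 0. Summing over it gives the difference of columns j and j+1 on the right;
    transposing reduces this to the row lemmas. *)
Lemma sum_row_lengths a : strict_desc a ->
  \sum_(l <- row_lengths a)
    ndet (size a) (fun i j => (row_count (nth 0%N a i) (nth 0%N l j))%:Z)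
  = ndet (size a) (fun i j => row_count_below (nth 0%N a i) (nth 0%N a j)).
Proof.
move=> da; under eq_bigr => l _ do rewrite ndet_tr.
have hs := size_mkseq (fun i => index_iota (maxn 1 (nth 0%N a i.+1))
                                           (nth 0%N a i)) (size a).
rewrite -{1}hs -(@ndet_row_sum _ _ _ _
  (fun l i => (row_count (nth 0%N a i) l)%:Z : int)) hs.
rewrite [RHS]ndet_tr [RHS]ndet_rowB => [|j _]; last first.
  by rewrite [nth _ _ (size a)]nth_default // row_count_below0.
apply: eq_ndet => i j lti ltj; rewrite nth_mkseq // row_count_belowB //.
exact: da.
Qed.

(** The possible first parts, in decreasing order: they start at 2 because a first part exceeds the
    length of a nonempty row. *)
Definition heads_range (m : nat) : seq nat := mkseq (fun i => m - i)%N (m - 1).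

Lemma mem_heads_range m x : (x \in heads_range m) = (1 < x <= m)%N.
Proof.
apply/mapP/idP=> [[i]|]; first by rewrite mem_iota => ? ->; lia.
by move=> x12; exists (m - x)%N; rewrite ?mem_iota; lia.
Qed.

Lemma strict_desc_sorted s : strict_desc s -> sorted gtn s.
Proof. by move=> ds; apply/(sortedP 0%N) => i /ltnW; apply: ds. Qed.

Lemma sorted_heads_range m : sorted gtn (heads_range m).
Proof.
by apply/(sortedP 0%N) => i; rewrite size_mkseq => lti; rewrite !nth_mkseq //=; lia.
Qed.

Lemma gtn_transitive : transitive gtn.
Proof. by move=> y x z /= yx zy; apply: ltn_trans yx. Qed.

Lemma mem_subseqs_heads_range m a :
  a \in subseqs (heads_range m) <->
  strict_desc a /\ (forall x, x \in a -> (1 < x <= m)%N).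
Proof.
rewrite mem_subseqs; split=> [sub|[da Ha]].
  have Ha x : x \in a -> (1 < x <= m)%N.
    by rewrite -mem_heads_range; apply: mem_subseq.
  split=> // i lti; have [lt_iS|ge_iS] := ltnP i.+1 (size a).
    have /(sortedP 0%N) := subseq_sorted gtn_transitive sub (sorted_heads_range m).
    exact.
  rewrite [nth _ _ i.+1]nth_default //; have := Ha _ (mem_nth 0%N lti) => /=; lia.
(* Two strictly decreasing lists with the same members are equal, so [a] is a filtering of the
   range. *)
suff <- : [seq x <- heads_range m | x \in a] = a by apply: filter_subseq.
apply: (irr_sorted_eq gtn_transitive); first by move=> x /=; apply: ltnn.
- exact: sorted_filter gtn_transitive _ _ (sorted_heads_range m).
- exact: strict_desc_sorted.
- move=> x; rewrite mem_filter mem_heads_range andb_idr //; exact: Ha.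
Qed.

Definition dpps (m : nat) : seq shifted_array :=
  flatten [seq flatten [seq fillings m l a | l <- row_lengths a]
          | a <- subseqs (heads_range m)].

Lemma head_row_lengths m a l :
  a \in subseqs (heads_range m) -> l \in row_lengths a -> (head 0%N l <= m)%N.
Proof.
move=> /mem_subseqs_heads_range[_ Ha] /mem_row_lengths[sl Hl].
rewrite -nth0; have [lt0|ge0] := ltnP 0 (size a); last by rewrite nth_default ?sl.
by have := Hl 0%N lt0; have := Ha _ (mem_nth 0%N lt0) => /=; lia.
Qed.

Lemma mem_fillings_dpps m a l pi :
  a \in subseqs (heads_range m) -> l \in row_lengths a ->
  pi \in fillings m l a <-> is_filling l a pi.
Proof.
move=> Ha Hl; apply: mem_fillings.
- by have /mem_row_lengths[] := Hl.
- exact: strict_desc_row_lengths Hl.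
- by have /mem_subseqs_heads_range[] := Ha.
- exact: head_row_lengths Ha Hl.
Qed.

Lemma uniq_dpps m : uniq (dpps m).
Proof.
apply: (uniq_flatten_key _ (map (head 0%N))).
- apply/uniq_subseqs/(sorted_uniq gtn_transitive _ (sorted_heads_range m)).
  by move=> x /=; apply: ltnn.
- move=> a Ha; apply: (uniq_flatten_key _ (map size)).
  + exact: uniq_row_lengths.
  + move=> l Hl; apply: uniq_fillings.
    * by have /mem_row_lengths[] := Hl.
    * exact: strict_desc_row_lengths Hl.
    * by have /mem_subseqs_heads_range[] := Ha.
    * exact: head_row_lengths Ha Hl.
  + by move=> l pi Hl /(mem_fillings_dpps _ _ _ _ Ha Hl)[].
- move=> a pi Ha /flatten_mapP[l Hl].
  by move=> /(mem_fillings_dpps _ _ _ _ Ha Hl)[].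
Qed.

(** After the three summations, a difference of consecutive columns of 1 + B retains a single
    length, hence one binomial coefficient, and the identity contributes the two Kronecker deltas.
    Reversing the indices gives the stated matrix. *)
Lemma size_dpps m : (size (dpps m))%:Z = \det (dpp_mx (m - 1)).
Proof.
transitivity (\sum_(a <- subseqs (heads_range m))
  ndet (size a) (fun i j => row_count_below (nth 0%N a i) (nth 0%N a j))).
  rewrite size_flatten_map; apply: eq_big_seq => a Ha.
  have /mem_subseqs_heads_range[da _] := Ha.
  rewrite size_flatten_map -sum_row_lengths //; apply: eq_big_seq => l Hl.
  have /mem_row_lengths[sl _] := Hl.
  rewrite size_fillings ?sl //; first exact: strict_desc_row_lengths Hl.
  exact: head_row_lengths Ha Hl.
rewrite -ndet_add1_principal_minors size_mkseq.
rewrite ndet_tr ndet_rowB => [|j ltj]; last first.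
  rewrite [nth _ _ (m - 1)]nth_default ?size_mkseq // row_count_below0 add0r.
  by rewrite (ltn_eqF ltj).
rewrite ndet_tr -[RHS]/(ndet _ (fun i j => dpp_coef i.+1 j.+1)) [RHS]ndet_rev.
apply: eq_ndet => i j lti ltj.
(* For the last column, the default 0 stands where the decreasing sequence would continue with 1;
   both bounds give an empty sum. *)
have nthS : row_count_below (nth 0%N (heads_range m) i)
                            (nth 0%N (heads_range m) j.+1)
          = row_count_below (nth 0%N (heads_range m) i) (m - j.+1).
  have [lt_jS|ge_jS] := ltnP j.+1 (m - 1).
    by rewrite [nth _ _ j.+1]nth_mkseq.
  rewrite [nth _ _ j.+1]nth_default ?size_mkseq //.
  have -> : (m - j.+1 = 1)%N by lia.
  by rewrite row_count_below0 /row_count_below big_geq.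
rewrite nthS !nth_mkseq // opprD addrACA row_count_belowB; last by lia.
have -> : maxn 1 (m - j.+1) = (m - j.+1)%N by lia.
have -> : (m - j = (m - j.+1).+1)%N by lia.
rewrite big_nat1 /dpp_coef addrA.
have -> : (m - i = (m - 1 - i.+1).+2)%N by lia.
rewrite /row_count; congr (_ + _ - _).
- by congr ('C(_, _))%:Z; lia.
- by rewrite natz; congr (Posz (nat_of_bool _)); lia.
- by rewrite natz; congr (Posz (nat_of_bool _)); lia.
Qed.

(** * Descending plane partitions as fillings *)

Lemma mem_parts pi x :
  x \in parts pi <->
  exists i p, (p < size (nth [::] pi i))%N /\ entry0 pi i p = x.
Proof.
split=> [/flattenP[r /(nthP [::])[i lti <-] /(nthP 0%N)[p ltp <-]]|].
  by exists i, p.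
move=> [i [p [ltp <-]]]; apply/flattenP; exists (nth [::] pi i); last exact: mem_nth.
by apply: mem_nth; rewrite ltnNge; apply/negP=> ge; move: ltp; rewrite nth_default.
Qed.

Lemma filling_le_head l a pi i p : is_filling l a pi ->
  (p < size (nth [::] pi i))%N -> (entry0 pi i p <= nth 0%N a i)%N.
Proof.
case=> _ <- W _ _; rewrite nth_map_head; elim: p => // p IH ltp.
by apply: leq_trans (W _ _ ltp) (IH (ltnW ltp)).
Qed.

Lemma row_ofS pi i : row_of pi i.+1 = nth [::] pi i.
Proof. by rewrite /row_of subn1. Qed.

Lemma muS pi i : mu pi i.+1 = (i + size (nth [::] pi i))%N.
Proof. by rewrite /mu row_ofS; lia. Qed.

Lemma entryS pi i p : entry pi i.+1 (i.+1 + p) = entry0 pi i p.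
Proof. by rewrite /entry row_ofS addKn. Qed.

Lemma mem_dpps m (pi : shifted_array) : pi \in dpps m <-> is_dpp pi /\ has_dimension m pi.
Proof.
split=> [/flatten_mapP[a Ha /flatten_mapP[l Hl]]|].
  move=> /(mem_fillings_dpps _ _ _ _ Ha Hl) fpi.
  have /mem_subseqs_heads_range[da a_le] := Ha.
  have /mem_row_lengths[sl l_in] := Hl.
  have [sz hd W C P] := fpi.
  have spa : size pi = size a by rewrite -hd size_map.
  have szi i : nth 0%N l i = size (nth [::] pi i) by rewrite -sz nth_map_size.
  have hdi i : nth 0%N a i = entry0 pi i 0 by rewrite -hd nth_map_head.
  (* This chain contains [dpp_first_part_gt_length], [dpp_first_part_le_prev_length] and
     nonemptiness; below the last row, the default 0 leaves only nonemptiness as lower bound. *)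
  have l_in' i : (i < size pi)%N ->
      (maxn 1 (entry0 pi i.+1 0) <= size (nth [::] pi i) < entry0 pi i 0)%N.
    by rewrite spa -!hdi -szi; apply: l_in.
  split; last first.
    move=> x /mem_parts[i [p [ltp <-]]].
    apply: leq_trans (filling_le_head _ _ _ _ _ fpi ltp) _.
    have [lti|gei] := ltnP i (size a); last by rewrite nth_default.
    by have /andP[] := a_le _ (mem_nth 0%N lti).
  split.
  - move=> [|i] // lti; rewrite row_ofS => r0.
    by have := l_in' _ lti; rewrite r0 /=; lia.
  - by move=> x /mem_parts[i [p [ltp <-]]]; apply: P.
  - move=> [|i] j // lti; rewrite muS => /andP[leij ltj].
    rewrite -(subnKC leij) -addnS !entryS; apply: W; lia.
  - move=> [|i] j // lti; rewrite muS => /andP[leij lej].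
    rewrite -(subnKC leij) entryS addSnnS entryS; apply: C; lia.
  - move=> [|i] // lti; rewrite muS -[X in entry _ _ X]addn0 entryS.
    by have := l_in' _ lti => /=; lia.
  - move=> [|[|i]] // lti; rewrite -[X in entry _ _ X]addn0 entryS subn1 /= muS.
    by have := l_in' i => /=; lia.
move=> [[ne pos W C gt le] dim].
have ne' i : (i < size pi)%N -> (0 < size (nth [::] pi i))%N.
  by move=> lti; rewrite lt0n size_eq0 -row_ofS; apply/eqP/ne.
have lt_size i p : (p < size (nth [::] pi i))%N -> (i < size pi)%N.
  by move=> ltp; rewrite ltnNge; apply/negP=> ge; move: ltp; rewrite nth_default.
have gt' i : (i < size pi)%N -> (size (nth [::] pi i) < entry0 pi i 0)%N.
  move=> lti; have := gt i.+1; rewrite muS -[X in entry _ _ X]addn0 entryS.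
  by have := ne' i lti; lia.
have le' i : (i.+1 < size pi)%N -> (entry0 pi i.+1 0 <= size (nth [::] pi i))%N.
  move=> lti; have := le i.+2; rewrite -[X in entry _ _ X]addn0 entryS subn1 /= muS.
  by have := ne' i; lia.
have le0 i : (size pi <= i)%N -> entry0 pi i 0 = 0%N.
  by move=> gei; rewrite -nth_map_head nth_default ?size_map.
have fpi : is_filling (map size pi) (map (head 0%N) pi) pi.
  split=> // i p ltp; have lti := lt_size _ _ ltp.
  - have := W i.+1 (i.+1 + p)%N; rewrite -addnS !entryS muS; apply; lia.
  - have := C i.+1 (i.+2 + p)%N; rewrite entryS addSnnS entryS muS; apply; lia.
  - by apply: pos; apply/mem_parts; exists i, p.
have Ha : map (head 0%N) pi \in subseqs (heads_range m).
  apply/mem_subseqs_heads_range; split=> [i|x].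
    rewrite size_map !nth_map_head => lti; have := gt' i lti.
    have [lt_iS|ge_iS] := ltnP i.+1 (size pi); last by rewrite (le0 i.+1) //; lia.
    by have := le' i lt_iS; lia.
  move=> /(nthP 0%N)[i]; rewrite size_map nth_map_head => lti <-.
  have -> : (entry0 pi i 0 <= m)%N.
    by apply: dim; apply/mem_parts; exists i, 0%N; rewrite ne'.
  by have := gt' i lti; have := ne' i lti; lia.
have Hl : map size pi \in row_lengths (map (head 0%N) pi).
  apply/mem_row_lengths; rewrite !size_map; split=> // i lti.
  rewrite !nth_map_head nth_map_size gt' // andbT geq_max ne' //=.
  have [lt_iS|ge_iS] := ltnP i.+1 (size pi); first exact: le'.
  by rewrite le0.
apply/flatten_mapP; exists (map (head 0%N) pi) => //.
apply/flatten_mapP; exists (map size pi) => //.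
exact/mem_fillings_dpps.
Qed.

Local Open Scope fset_scope.

Theorem corollary7 (m : nat) (hm : (1 <= m)%N) :
  exists D : {fset shifted_array},
    (forall pi : shifted_array, pi \in D <-> is_dpp pi /\ has_dimension m pi)
    /\ (#|` D|)%:Z = \det (dpp_mx (m - 1)).
Proof.
exists (seq_fset tt (dpps m)); split=> [pi|].
  by rewrite seq_fsetE; apply: mem_dpps.
by rewrite size_seq_fset undup_id ?uniq_dpps // size_dpps.
Qed.
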